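(* Let $A,B,G$ be three groups, with $G$ finitely presented and $B$ infinite. Then $G$ is isomorphic to a subgroup of $A \wr B$ if and only if either $G$ is isomorphic to a subgroup of $B$, or there exists an $n \geq 1$ such that $G$ is a (subgroup in $A^n$)-by-(finite subgroup in $B$).
   Context: $A \wr B := \bigoplus_B A \rtimes B$ is the restricted wreath product, $B$ acting on $\bigoplus_B A$ by permuting the coordinates through left multiplication on $B$. A group $G$ is a (subgroup in $A^n$)-by-(finite subgroup in $B$) if there is a short exact sequence $1\to N\to G\to F\to 1$ where $N$ is isomorphic to a subgroup of $A^n$ and $F$ is isomorphic to a finite subgroup of $B$. *)

(* Defs.v *)
From HB Require Import structures.
From mathcomp Require Import all_boot finmap all_classical.

Set Implicit Arguments.
Unset Strict Implicit.
Unset Printing Implicit Defensive.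

Local Open Scope group_scope.
Local Open Scope classical_set_scope.

(* Groups, possibly infinite, are [groupType]s.  Such a type carries a choice
   operator, which classically every type does, so this is no restriction. *)

Section DirectSum.
Variables (A : groupType) (B : choiceType).

Definition dsum := {fsfun B -> A with 1}.

HB.instance Definition _ := Choice.copy dsum {fsfun B -> A with 1}.

Implicit Types f g h : dsum.

Definition dsum_one : dsum := [fsfun with 1].

Definition dsum_mul f g : dsum :=
  [fsfun x in (finsupp f `|` finsupp g)%fset => f x * g x].

Definition dsum_inv f : dsum := [fsfun x in finsupp f => (f x)^-1].

Lemma dsum_oneE x : dsum_one x = 1.
Proof. by rewrite /dsum_one fsfun0E. Qed.

Lemma dsum_mulE f g x : dsum_mul f g x = f x * g x.
Proof.
rewrite fsfun_fun in_fsetU.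
by case: finsuppP => _ //; case: finsuppP => _ //=; rewrite mulg1.
Qed.

Lemma dsum_invE f x : dsum_inv f x = (f x)^-1.
Proof. by rewrite fsfun_fun; case: finsuppP; rewrite ?invg1. Qed.

Fact dsum_mulA : associative dsum_mul.
Proof. by move=> f g h; apply/fsfunP => x; rewrite !dsum_mulE mulgA. Qed.

Fact dsum_mul1 : left_id dsum_one dsum_mul.
Proof. by move=> f; apply/fsfunP => x; rewrite dsum_mulE dsum_oneE mul1g. Qed.

Fact dsum_mulr1 : right_id dsum_one dsum_mul.
Proof. by move=> f; apply/fsfunP => x; rewrite dsum_mulE dsum_oneE mulg1. Qed.

Fact dsum_mulV : left_inverse dsum_one dsum_inv dsum_mul.
Proof.
by move=> f; apply/fsfunP => x; rewrite dsum_mulE dsum_invE dsum_oneE mulVg.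
Qed.

Fact dsum_mulrV : right_inverse dsum_one dsum_inv dsum_mul.
Proof.
by move=> f; apply/fsfunP => x; rewrite dsum_mulE dsum_invE dsum_oneE mulgV.
Qed.

HB.instance Definition _ := isGroup.Build dsum
  dsum_mulA dsum_mul1 dsum_mulr1 dsum_mulV dsum_mulrV.

End DirectSum.

Section Wreath.
Variables A B : groupType.

(* Left multiplication by [b] moves the coordinate at [x] to [b * x]; hence
   the coordinate at [x] of the result is the old one at [b^-1 * x]. *)
Definition shift (b : B) (f : dsum A B) : dsum A B :=
  [fsfun x in [fset b * y | y in finsupp f]%fset => f (b^-1 * x)].

Lemma shiftE b f x : shift b f x = f (b^-1 * x).
Proof.
rewrite fsfun_fun; case: ifPn => // xNb; rewrite fsfun_dflt //.
apply: contra xNb => xb; apply/imfsetP; exists (b^-1 * x) => //.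
by rewrite mulVKg.
Qed.

Lemma shift1 f : shift 1 f = f.
Proof. by apply/fsfunP => x; rewrite shiftE invg1 mul1g. Qed.

Lemma shiftM b c f : shift (b * c) f = shift b (shift c f).
Proof. by apply/fsfunP => x; rewrite !shiftE invgM mulgA. Qed.

Lemma shift_mul b f g : shift b (f * g) = shift b f * shift b g.
Proof. by apply/fsfunP => x; rewrite !(shiftE, dsum_mulE). Qed.

Record wreath := Wreath { lamps : dsum A B; cursor : B }.

Definition pair_of_wreath (u : wreath) := (lamps u, cursor u).
Definition wreath_of_pair (p : dsum A B * B) := Wreath p.1 p.2.

Lemma pair_of_wreathK : cancel pair_of_wreath wreath_of_pair.
Proof. by case. Qed.

HB.instance Definition _ := Choice.copy wreath (can_type pair_of_wreathK).

Definition wreath_one := Wreath 1 1.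

Definition wreath_mul (u v : wreath) :=
  Wreath (lamps u * shift (cursor u) (lamps v)) (cursor u * cursor v).

Definition wreath_inv (u : wreath) :=
  Wreath (shift (cursor u)^-1 (lamps u)^-1) (cursor u)^-1.

Lemma shift_one b : shift b 1 = 1.
Proof. by apply/fsfunP => x; rewrite shiftE !dsum_oneE. Qed.

Fact wreath_mulA : associative wreath_mul.
Proof.
by move=> [f b] [g c] [h d]; rewrite /wreath_mul/= shift_mul shiftM !mulgA.
Qed.

Fact wreath_mul1 : left_id wreath_one wreath_mul.
Proof. by move=> [f b]; rewrite /wreath_mul/= shift1 !mul1g. Qed.

Fact wreath_mulr1 : right_id wreath_one wreath_mul.
Proof. by move=> [f b]; rewrite /wreath_mul/= shift_one !mulg1. Qed.

Fact wreath_mulV : left_inverse wreath_one wreath_inv wreath_mul.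
Proof.
by move=> [f b]; rewrite /wreath_mul/= -shift_mul !mulVg shift_one.
Qed.

Fact wreath_mulrV : right_inverse wreath_one wreath_inv wreath_mul.
Proof.
by move=> [f b]; rewrite /wreath_mul/= -shiftM !mulgV shift1 mulgV.
Qed.

HB.instance Definition _ := isGroup.Build wreath
  wreath_mulA wreath_mul1 wreath_mulr1 wreath_mulV wreath_mulrV.

End Wreath.

(* The letter [(i, false)] stands for the i-th generator and [(i, true)] for
   its inverse. *)
Definition word n := seq ('I_n * bool).

Definition eval n (G : groupType) (g : 'I_n -> G) (w : word n) : G :=
  \prod_(a <- w) (if a.2 then (g a.1)^-1 else g a.1).

(* Equality in the group < x_0, ..., x_(n-1) | r = 1 for r in R >. *)
Inductive pres_eq n (R : seq (word n)) : word n -> word n -> Prop :=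
| pres_refl u : pres_eq R u u
| pres_sym u v : pres_eq R u v -> pres_eq R v u
| pres_trans u v w : pres_eq R u v -> pres_eq R v w -> pres_eq R u w
| pres_cat u u' v v' :
    pres_eq R u u' -> pres_eq R v v' -> pres_eq R (u ++ v) (u' ++ v')
| pres_cancel i b : pres_eq R [:: (i, b); (i, ~~ b)] [::]
| pres_rel r : r \in R -> pres_eq R r [::].

(* The words modulo [pres_eq R] form a group isomorphic to [G]. *)
Definition finitely_presented (G : groupType) :=
  exists (n : nat) (R : seq (word n)) (g : 'I_n -> G),
    (forall x, exists w, eval g w = x) /\
    (forall u v, eval g u = eval g v <-> pres_eq R u v).

Definition isom_to (G H : groupType) (K : groupClosed H) :=
  exists f : {multiplicative G -> H}, injective f /\ range f = [set` K].

Definition isom_subgroup (G H : groupType) :=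
  exists K : groupClosed H, isom_to G K.

Definition isom_finite_subgroup (G H : groupType) :=
  exists K : groupClosed H, finite_set [set` K] /\ isom_to G K.

Definition short_exact (N G F : groupType)
    (i : {multiplicative N -> G}) (p : {multiplicative G -> F}) :=
  [/\ injective i, range i = p @^-1` [set 1] & range p = [set: F]].

(* [G] is a (subgroup in P)-by-(finite subgroup in B). *)
Definition subgroup_by_finite_subgroup (P B G : groupType) :=
  exists (N F : groupType)
    (i : {multiplicative N -> G}) (p : {multiplicative G -> F}),
    [/\ short_exact i p, isom_subgroup N P & isom_finite_subgroup F B].

(* Main.v *)
Require Import Defs.
From HB Require Import structures.
From mathcomp Require Import all_boot finmap all_classical.

(** Let [p] be the restriction to [G] of the projection of [A wr B] onto [B];
    the kernel of [p] is [G] intersected with the direct sum of the lamp groups.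

    The heart of the matter is [finite_projection]: if [G] is finitely presented
    and some [z <> 1] of [G] lies in that direct sum, then [p G] is finite.  The
    wreath product is the direct limit of the groups in which only those lamp groups
    commute whose positions differ by an element of a fixed finite subset of
    [B]; a finite presentation of [G] only sees finitely many commutations, so
    [G] maps to such a group already.  There, [z] commutes with all its
    conjugates by elements [m] with [p m] far away, since in [G] they have
    disjoint supports; but a nontrivial element of a lamp group does not commute
    with lamps it has not been forced to commute with.

    To detect this it is enough to keep two positions [u] and [v] which are
    never forced to commute, and to send the lamp groups at [u] and [v] to any
    group [Q] generated by two copies of [A] such that elements commuting with
    some [a <> 1] of the first copy die in the second one.  The group
    [Q = A wr A] does this, the first copy being the lamp group at [1] and the
    second the base.  Since [B] moves [u] and [v] around, one does this for all
    translates [(c * u, c * v)] at once, and the target is [Q wr B] ([lift]).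
    The set-theoretic map [lift] from [A wr B] to [Q wr B] is not a
    homomorphism, but on the values of a given word it behaves like one as soon
    as [u] and [v] are far apart ([tracks_word]), so by von Dyck's theorem it
    induces a homomorphism on [G].

    Once [p G] is finite, finite generation bounds the supports of all elements
    of [G] ([lamps_bounded]), so the kernel of [p] embeds in a finite power
    of [A].

    Conversely, an extension of a subgroup of [A^n] by a finite [F <= B]
    embeds in [A^n wr F] (Kaloujnine-Krasner), which lies in [A wr B]: as [B] is
    infinite, there are [n] distinct cosets [F b_k], and the [k]-th copy of [A]
    at position [x] goes to position [x b_k] ([kaloujnine_krasner]). *)

Set Implicit Arguments.
Unset Strict Implicit.
Unset Printing Implicit Defensive.

Local Open Scope group_scope.
Local Open Scope classical_set_scope.

(** * Homomorphisms, kernels and images of possibly infinite groups *)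

Section Homomorphisms.
Variables (G H : groupType) (f : {multiplicative G -> H}).

Lemma hom1 : f 1 = 1.
Proof. by apply: (mulIg (f 1)); rewrite -gmulfM !mul1g. Qed.

Lemma homV x : f x^-1 = (f x)^-1.
Proof. by apply: (mulIg (f x)); rewrite -gmulfM !mulVg hom1. Qed.

Lemma hom_injP : injective f <-> forall x, f x = 1 -> x = 1.
Proof.
split=> [fI x|f1 x y fxy]; first by rewrite -{1}hom1 => /fI.
by apply/divg1_eq/f1; rewrite gmulfM homV fxy mulgV.
Qed.

Definition image_pred : {pred H} := mem (range f).

Fact image_mulg : mulg_closed image_pred.
Proof.
move=> _ _ /set_mem[x _ <-] /set_mem[y _ <-].
by apply: mem_set; exists (x * y); rewrite ?gmulfM.
Qed.

Fact image_one : 1 \in image_pred.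
Proof. by apply: mem_set; exists 1; rewrite ?hom1. Qed.

Fact image_invg : invg_closed image_pred.
Proof.
by move=> _ /set_mem[x _ <-]; apply: mem_set; exists x^-1; rewrite ?homV.
Qed.

HB.instance Definition _ := isMulClosed.Build H image_pred image_mulg.
HB.instance Definition _ := isMul1Closed.Build H image_pred image_one.
HB.instance Definition _ := isInvClosed.Build H image_pred image_invg.

Definition kernel_pred : {pred G} := fun x => f x == 1.

Fact kernel_mulg : mulg_closed kernel_pred.
Proof.
by move=> x y /eqP fx /eqP fy; apply/eqP; rewrite gmulfM fx fy mulg1.
Qed.

Fact kernel_one : 1 \in kernel_pred.
Proof. by apply/eqP; rewrite hom1. Qed.

Fact kernel_invg : invg_closed kernel_pred.
Proof. by move=> x /eqP fx; apply/eqP; rewrite homV fx invg1. Qed.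

HB.instance Definition _ := isMulClosed.Build G kernel_pred kernel_mulg.
HB.instance Definition _ := isMul1Closed.Build G kernel_pred kernel_one.
HB.instance Definition _ := isInvClosed.Build G kernel_pred kernel_invg.

Definition image_group : groupClosed H := image_pred.
Definition kernel_group : groupClosed G := kernel_pred.

Lemma image_set : [set` image_group] = range f.
Proof. by apply/seteqP; split=> x; rewrite /= inE. Qed.

End Homomorphisms.

Lemma make_hom (G H : groupType) (f : G -> H) :
  {morph f : x y / x * y} -> exists h : {multiplicative G -> H}, h =1 f.
Proof.
move=> fM.
pose m := isMultiplicative.Build G H f fM.
by exists (HB.pack f m : {multiplicative G -> H}).
Qed.

Section Subgroups.
Variables (G : groupType) (K : groupClosed G).

Definition subgroup_type := {x : G | x \in K}.
HB.instance Definition _ := SubChoice.on subgroup_type.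
Fact subgroup_closed : group_closed (fun x => x \in K).
Proof. by split; [exact: gpred1 | move=> x y; exact: gpredF]. Qed.

HB.instance Definition _ :=
  SubChoice_isSubGroup.Build G (fun x => x \in K) subgroup_type subgroup_closed.

End Subgroups.

Lemma isom_subgroupP (G H : groupType) :
  isom_subgroup G H <-> exists f : {multiplicative G -> H}, injective f.
Proof.
split=> [[K [f [fI _]]]|[f fI]]; first by exists f.
by exists (image_group f), f; split=> //; rewrite image_set.
Qed.

Lemma isom_finite_subgroupP (G H : groupType) :
  isom_finite_subgroup G H <->
  exists f : {multiplicative G -> H}, injective f /\ finite_set (range f).
Proof.
split=> [[K [Kfin [f [fI fK]]]]|[f [fI ffin]]]; first by exists f; rewrite fK.
by exists (image_group f); split; rewrite ?image_set//; exists f; rewrite image_set.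
Qed.

(** Taking [k] on the whole of [G], and multiplicative on the kernel of [p],
    lets it be given by a formula such as the tuple of lamps of [x], which is
    not multiplicative elsewhere. *)
Lemma extension_of_kernel (P B G : groupType) (p : {multiplicative G -> B})
    (k : G -> P) :
  finite_set (range p) ->
  (forall x y, p x = 1 -> p y = 1 -> k (x * y) = k x * k y) ->
  (forall x, p x = 1 -> k x = 1 -> x = 1) ->
  subgroup_by_finite_subgroup P B G.
Proof.
move=> pfin kM kI.
pose N := subgroup_type (kernel_group p); pose F := subgroup_type (image_group p).
have pF x : p x \in image_group p by apply: mem_set; exists x.
have pN (x : N) : p (\val x) = 1 by exact/eqP/(valP x).
have [i iE] := @make_hom N G \val (fun x y => erefl).
have [q qE] := @make_hom F B \val (fun x y => erefl).
have [p' p'E] : exists p' : {multiplicative G -> F}, forall x, \val (p' x) = p x.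
  have [|h hE] := @make_hom G F (fun x => Sub (p x) (pF x)).
    by move=> x y; apply/val_inj; rewrite /= gmulfM.
  by exists h => x; rewrite hE.
have [k' k'E] : exists k' : {multiplicative N -> P}, forall x, k' x = k (\val x).
  by apply: make_hom => x y; rewrite valM kM.
exists N, F, i, p'; split.
- split.
  + by move=> x y; rewrite !iE => /val_inj.
  + apply/seteqP; split=> [_ [x _ <-]|x /= p'x].
      by apply/val_inj; rewrite p'E iE pN.
    have px : x \in kernel_group p by apply/eqP; rewrite -p'E p'x.
    by exists (Sub x px); rewrite ?iE.
  + apply/seteqP; split=> // y _; have /set_mem[x _ pxy] := valP y.
    by exists x => //; apply/val_inj; rewrite p'E.
- apply/isom_subgroupP; exists k'; apply/hom_injP => x; rewrite k'E => kx.
  by apply/val_inj/kI; rewrite ?pN.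
- apply/isom_finite_subgroupP; exists q; split.
    by move=> x y; rewrite !qE => /val_inj.
  apply: sub_finite_set pfin => _ [y _ <-]; rewrite qE.
  exact/set_mem/(valP y).
Qed.

(** * Elements of direct sums and wreath products *)

Definition dsum_of (A : groupType) (B : choiceType) (P : {fset B}) (L : B -> A)
  : dsum A B := [fsfun y in P => L y].

Lemma dsum_ofE (A : groupType) (B : choiceType) (P : {fset B}) (L : B -> A) y :
  (y \notin P -> L y = 1) -> dsum_of P L y = L y.
Proof. by move=> PL; rewrite fsfun_fun; case: ifPn => // /PL ->. Qed.

Lemma wreath_eqP (A B : groupType) (x y : wreath A B) :
  cursor x = cursor y -> (forall b, lamps x b = lamps y b) -> x = y.
Proof. by case: x y => [l b] [l' b'] /= -> /fsfunP ->. Qed.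

Section WreathLemmas.
Variables A B : groupType.
Implicit Types x y : wreath A B.

Lemma cursorM x y : cursor (x * y) = cursor x * cursor y. Proof. by []. Qed.
Lemma cursorV x : cursor x^-1 = (cursor x)^-1. Proof. by []. Qed.
Lemma lampsM x y b : lamps (x * y) b = lamps x b * lamps y ((cursor x)^-1 * b).
Proof. by rewrite /= dsum_mulE shiftE. Qed.
Lemma lampsV x b : lamps x^-1 b = (lamps x (cursor x * b))^-1.
Proof. by rewrite /= shiftE dsum_invE invgK. Qed.
Lemma lamps1 b : lamps (1 : wreath A B) b = 1.
Proof. exact: dsum_oneE. Qed.

Lemma commute_disjoint x y :
  cursor x = 1 -> cursor y = 1 ->
  (forall b, lamps x b = 1 \/ lamps y b = 1) -> x * y = y * x.
Proof.
move=> cx cy xy; apply: wreath_eqP => [|b]; first by rewrite !cursorM cx cy.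
by rewrite !lampsM cx cy invg1 !mul1g; case: (xy b) => ->; rewrite mulg1 mul1g.
Qed.

(** For [B = A], [lamp] and [base] are two copies of [A] generating
    [A wr A]. *)
Definition base (b : B) : wreath A B := Wreath 1 b.
Definition lamp (a : A) : wreath A B := Wreath (dsum_of [fset 1]%fset (fun=> a)) 1.

Lemma lampE a b : lamps (lamp a) b = if b == 1 then a else 1.
Proof. by rewrite fsfun_fun in_fset1. Qed.

Lemma lampM a a' : lamp (a * a') = lamp a * lamp a'.
Proof.
apply: wreath_eqP => [|b]; first by rewrite cursorM mulg1.
by rewrite lampsM invg1 mul1g !lampE; case: ifP; rewrite ?mulg1.
Qed.

Lemma baseM b b' : base (b * b') = base b * base b'.
Proof. by apply: wreath_eqP => [|c] //; rewrite lampsM !lamps1 mulg1. Qed.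

Lemma lamp1 : lamp 1 = 1.
Proof. by apply: (mulIg (lamp 1)); rewrite -lampM !mul1g. Qed.

Lemma lampV a : lamp a^-1 = (lamp a)^-1.
Proof. by apply: (mulIg (lamp a)); rewrite -lampM !mulVg lamp1. Qed.

Lemma baseV b : base b^-1 = (base b)^-1.
Proof. by apply: (mulIg (base b)); rewrite -baseM !mulVg. Qed.

(** Conjugation by [x] moves the support [{1}] of [lamp a] to [{cursor x}]. *)
Lemma commute_lamp a x : a != 1 -> lamp a * x = x * lamp a -> cursor x = 1.
Proof.
move=> a1 /(congr1 (fun z => lamps z (cursor x))).
rewrite !lampsM invg1 mul1g mulVg !lampE eqxx.
have [//|_] := eqVneq; rewrite mul1g => /(congr1 (fun z => (lamps x (cursor x))^-1 * z)).
by rewrite mulKg mulVg => a1'; rewrite -a1' eqxx in a1.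
Qed.

Lemma base_embeds : exists f : {multiplicative B -> wreath A B}, injective f.
Proof.
by have [f fE] := make_hom baseM; exists f => b c; rewrite !fE => -[].
Qed.

End WreathLemmas.

(** * Embedding extensions in wreath products *)

(** The [b k] are chosen greedily, each outside the finite set of the [c * b k]
    already present; for [C] a subgroup, the cosets [C * b k] are distinct. *)
Lemma distinct_cosets (B : groupType) (C : set B) :
  infinite_set [set: B] -> finite_set C -> forall n,
  exists b : nat -> B, forall k l c, (k < l < n)%N -> C c -> c * b k != b l.
Proof.
move=> Binf Cfin; elim=> [|n [b bP]]; first by exists (fun=> 1) => k l c; rewrite andbF.
pose D := [set c * b k | c in C & k in `I_n].
have /(infinite_setN0)[z [_ zD]] : infinite_set ([set: B] `\` D).
  by apply: infinite_setD => //; apply: finite_image2.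
exists (fun k => if k == n then z else b k) => k l c /andP[kl ln] Cc.
rewrite (ltn_eqF (leq_trans kl ln)).
have [ln'|lN] := eqVneq l n; last by apply: bP => //; rewrite kl ltn_neqAle lN.
by apply/eqP => czb; apply: zD; exists c => //; exists k => //=; rewrite -ln'.
Qed.

Section KaloujnineKrasner.
Variables (A B G N F : groupType) (n : nat).
Variables (i : {multiplicative N -> G}) (p : {multiplicative G -> F}).
Variables (j : {multiplicative N -> {ffun 'I_n -> A}}) (q : {multiplicative F -> B}).
Hypotheses (ip : short_exact i p) (jI : injective j) (qI : injective q).
Hypotheses (qfin : finite_set (range q)) (Binf : infinite_set [set: B]).

(** With [s] a section of [p], the lamp of [g] at [q x * b k] is the [k]-th
    coordinate of the element [s(x)^-1 * g * s(p(g)^-1 * x)] of [N]. *)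
Lemma kaloujnine_krasner : exists f : {multiplicative G -> wreath A B}, injective f.
Proof.
have [iI ri rp] := ip.
have /choice[s sP] x : exists y, p y = x.
  by have : range p x by [rewrite rp]; case=> y _; exists y.
have /choice[kap kapP] : forall gx : G * F, exists z : N,
    i z = (s gx.2)^-1 * gx.1 * s ((p gx.1)^-1 * gx.2).
  move=> [g x] /=; set w := _ * s _.
  suff : range i w by case=> z _ <-; exists z.
  by rewrite ri /= /w !gmulfM homV !sP mulgA mulgK mulVg.
(* The cocycle identity which makes the embedding multiplicative. *)
have kapM g h x : kap (g * h, x) = kap (g, x) * kap (h, (p g)^-1 * x).
  apply: iI; rewrite gmulfM !kapP /= gmulfM invgM -!mulgA; congr (_ * (_ * _)).
  by rewrite mulVKg.
have [b bP] := distinct_cosets Binf qfin n.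
pose e (xk : F * 'I_n) := q xk.1 * b xk.2.
have eI : injective e.
  suff e_le x y (k l : 'I_n) : e (x, k) = e (y, l) -> (k >= l)%N.
    move=> [x k] [y l] /[dup] /e_le kl /[dup] /esym /e_le lk.
    have -> : k = l by apply/val_inj/anti_leq; rewrite kl lk.
    by move=> /mulIg/qI /= ->.
  rewrite leqNgt => exy; apply/negP => kl.
  have [] := negP (@bP k l (q (y^-1 * x)) _ _).
  - by rewrite kl ltn_ord.
  - by exists (y^-1 * x).
  - by apply/eqP/(mulgI (q y)); rewrite mulgA -gmulfM mulVKg.
(* [dec] is a partial inverse of the injection [e]; lamps outside the range
   of [e] are off. *)
have /choice[dec decP] y : exists o,
    if o is Some xk then e xk = y else forall xk, e xk <> y.
  have [[xk exk]|eN] := pselect (exists xk, e xk = y); first by exists (Some xk).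
  by exists None => xk exk; apply: eN; exists xk.
have dece xk : dec (e xk) = Some xk.
  by have := decP (e xk); case: (dec _) => [xk' /eI -> //|/(_ xk)].
have e_shift g x k : e ((p g)^-1 * x, k) = (q (p g))^-1 * e (x, k).
  by rewrite /e /= gmulfM homV mulgA.
pose L g y := if dec y is Some xk then j (kap (g, xk.1)) xk.2 else 1.
have [Q QE] : exists Q : {fset B}, forall xk, e xk \in Q.
  have /finite_fsetP[Q QE] : finite_set [set x * y | x in range q & y in b @` `I_n].
    by apply: finite_image2 => //; apply: finite_image.
  exists Q => xk.
  suff : [set` Q] (e xk) by [].
  rewrite -QE; exists (q xk.1); first by exists xk.1.
  by exists (b xk.2) => //; exists xk.2 => //=; apply: ltn_ord.
have LQ g y : dsum_of Q (L g) y = L g y.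
  apply: dsum_ofE; rewrite /L; have := decP y; case: (dec y) => // xk <-.
  by rewrite QE.
have [|f fE] := @make_hom G (wreath A B) (fun g => Wreath (dsum_of Q (L g)) (q (p g))).
  move=> g h; apply: wreath_eqP => [|y] /=; first by rewrite !gmulfM.
  rewrite dsum_mulE shiftE !LQ /L.
  have := decP y; case: (dec y) => [[x k] <-|eN].
    by rewrite -e_shift dece /= kapM gmulfM ffunE.
  have := decP ((q (p g))^-1 * y); case: (dec _) => [[x k] exk|]; last by rewrite mul1g.
  by case: (eN (p g * x, k)); rewrite /e /= gmulfM -mulgA -/(e (x, k)) exk mulVKg.
exists f; apply/hom_injP => g; rewrite fE => -[fL qpg].
have pg : p g = 1 by apply: qI; rewrite qpg hom1.
have kg : kap (g, 1) = 1.
  apply: jI; rewrite hom1; apply/ffunP => k; rewrite ffunE.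
  have := LQ g (e (1, k)); rewrite fL dsum_oneE /L dece /= => <-.
  by [].
have := kapP (g, 1); rewrite kg hom1 /= pg mulg1 invg1.
move=> /(congr1 (fun z => s 1 * z * (s 1)^-1)).
by rewrite !mulgA mulg1 !mulgV mul1g mulgK.
Qed.
End KaloujnineKrasner.

Lemma extension_embeds (A B G : groupType) n :
  infinite_set [set: B] ->
  subgroup_by_finite_subgroup {ffun 'I_n -> A} B G ->
  isom_subgroup G (wreath A B).
Proof.
move=> Binf [N [F [i [p [ip /isom_subgroupP[j jI]]]]]].
move=> /isom_finite_subgroupP[q [qI qfin]].
by apply/isom_subgroupP; apply: kaloujnine_krasner ip jI qI qfin Binf.
Qed.

(** * Words and finite presentations *)

Lemma eval_cons n (G : groupType) (g : 'I_n -> G) a (w : word n) :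
  eval g (a :: w) = (if a.2 then (g a.1)^-1 else g a.1) * eval g w.
Proof. exact: big_cons. Qed.

Lemma eval_cat n (G : groupType) (g : 'I_n -> G) (u v : word n) :
  eval g (u ++ v) = eval g u * eval g v.
Proof. exact: big_cat. Qed.

Lemma eval_hom n (G H : groupType) (f : {multiplicative G -> H})
    (g : 'I_n -> G) (w : word n) :
  eval (f \o g) w = f (eval g w).
Proof.
elim: w => [|[i s] w IH]; first by rewrite /eval !big_nil hom1.
by rewrite !eval_cons gmulfM IH /=; case: s; rewrite ?homV.
Qed.

Lemma von_dyck n (R : seq (word n)) (G : groupType) (g : 'I_n -> G) :
  (forall r, r \in R -> eval g r = 1) ->
  forall u v, pres_eq R u v -> eval g u = eval g v.
Proof.
move=> gR u v; elim=> //.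
- by move=> ? ? ? _ -> _ ->.
- by move=> ? ? ? ? _ IHu _ IHv; rewrite !eval_cat IHu IHv.
- by move=> i [] /=; rewrite !eval_cons /= mulgA ?mulVg ?mulgV mul1g.
- by move=> r /gR ->; rewrite /eval big_nil.
Qed.

(** * Lifting words to [(A wr A) wr B] *)

Section Lift.
Variables (A B : groupType).
Variables (u v : B).
Notation W := (wreath A B).
Notation Q := (wreath A A).
Notation T := (wreath Q B).

(** Multiplying the two letters in this order is an arbitrary choice: it only
    matters when both lamps are on, and even then not for the image in the
    second copy of [A]. *)
Definition lift (x : W) : T :=
  Wreath (dsum_of ([fset b * u^-1 | b in finsupp (lamps x)] `|`
                   [fset b * v^-1 | b in finsupp (lamps x)])%fset
            (fun c => lamp A (lamps x (c * u)) * base A (lamps x (c * v))))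
    (cursor x).

Lemma lift_lamps x c :
  lamps (lift x) c = lamp A (lamps x (c * u)) * base A (lamps x (c * v)).
Proof.
rewrite /= dsum_ofE // in_fsetU negb_or => /andP[cu cv].
have out d : c \notin [fset b * d^-1 | b in finsupp (lamps x)]%fset ->
    lamps x (c * d) = 1.
  move=> cd; apply: fsfun_dflt; apply: contra cd => cd.
  by apply/imfsetP; exists (c * d) => //=; rewrite mulgK.
by rewrite !out // lamp1 mul1g.
Qed.

(** [P] is meant to contain all the positions ever lit by a word evaluating to
    [x], and [y] to be the value of the same word under [lift].  If at most one of
    [c * u] and [c * v] is in [P], all the letters seen at [c] lie in
    the same copy of [A], so that [y] is determined by [x] there.  In general,
    only the image of [y] in the second copy of [A] is. *)
Record tracks (P : {fset B}) (x : W) (y : T) : Prop := Tracks {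
  tracks_cursor : cursor y = cursor x;
  tracks_v c : cursor (lamps y c) = lamps x (c * v);
  tracks_lamp c : c * v \notin P -> lamps y c = lamp A (lamps x (c * u));
  tracks_base c : c * u \notin P -> lamps y c = base A (lamps x (c * v)) }.

Definition translate (b : B) (P : {fset B}) := [fset b * x | x in P]%fset.

Lemma in_translate b P x : (x \in translate b P) = (b^-1 * x \in P).
Proof.
apply/imfsetP/idP => [[y yP ->]|xP]; first by rewrite mulKg.
by exists (b^-1 * x) => //; rewrite mulVKg.
Qed.

Lemma tracks_one P : tracks P 1 1.
Proof.
by split=> // c *; rewrite !lamps1 ?lamp1.
Qed.

Lemma tracks_mul P P' x x' y y' : tracks P x y -> tracks P' x' y' ->
  tracks (P `|` translate (cursor x) P')%fset (x * x') (y * y').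
Proof.
move=> [cy yv yl yb] [cy' yv' yl' yb']; split.
- by rewrite !cursorM cy cy'.
- by move=> c; rewrite !lampsM cursorM yv yv' cy mulgA.
- move=> c; rewrite in_fsetU negb_or in_translate mulgA => /andP[cP cP'].
  by rewrite !lampsM cy yl // yl' // lampM mulgA.
- move=> c; rewrite in_fsetU negb_or in_translate mulgA => /andP[cP cP'].
  by rewrite !lampsM cy yb // yb' // baseM mulgA.
Qed.

Lemma tracks_inv P x y :
  tracks P x y -> tracks (translate (cursor x)^-1 P) x^-1 y^-1.
Proof.
move=> [cy yv yl yb]; split.
- by rewrite !cursorV cy.
- by move=> c; rewrite !lampsV cursorV yv cy mulgA.
- move=> c; rewrite in_translate invgK mulgA => cP.
  by rewrite !lampsV cy yl // lampV mulgA.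
- move=> c; rewrite in_translate invgK mulgA => cP.
  by rewrite !lampsV cy yb // baseV mulgA.
Qed.

Lemma tracks_lift x : tracks (finsupp (lamps x)) x (lift x).
Proof.
split=> // c; first by rewrite lift_lamps cursorM mul1g.
- by move=> cP; rewrite lift_lamps (fsfun_dflt cP) mulg1.
- by move=> cP; rewrite lift_lamps (fsfun_dflt cP) lamp1 mul1g.
Qed.

Lemma tracks_sub P P' x y : (P `<=` P')%fset -> tracks P x y -> tracks P' x y.
Proof.
move=> /fsubsetP PP' [cy yv yl yb]; split=> // c cP.
- by apply: yl; apply: contra cP; apply: PP'.
- by apply: yb; apply: contra cP; apply: PP'.
Qed.

Lemma tracks_trivial P y :
  (forall c, c * u \in P -> c * v \notin P) -> tracks P 1 y -> y = 1.
Proof.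
move=> uvP [cy _ yl yb]; apply: wreath_eqP => // c; rewrite lamps1.
have [cu|cu] := boolP (c * u \in P); first by rewrite yl ?uvP ?lamps1 ?lamp1.
by rewrite yb ?lamps1.
Qed.

End Lift.

(** It is essential that [P] does not depend on [u] and [v], which will be
    chosen far apart with respect to [P]. *)
Lemma tracks_word (A B : groupType) n (x : 'I_n -> wreath A B) (w : word n) :
  exists P, forall u v, tracks u v P (eval x w) (eval (lift u v \o x) w).
Proof.
elim: w => [|[i s] w [P IH]].
  by exists fset0 => u v; rewrite /eval !big_nil; apply: tracks_one.
have [P' xP'] : exists P', forall u v,
    tracks u v P' (if s then (x i)^-1 else x i)
                  (if s then (lift u v (x i))^-1 else lift u v (x i)).
  case: s; eexists => u v; last exact: tracks_lift.
  by apply: tracks_inv; apply: tracks_lift.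
by eexists => u v; rewrite !eval_cons; apply: tracks_mul.
Qed.

Lemma tracks_words (A B : groupType) n (x : 'I_n -> wreath A B) (R : seq (word n)) :
  exists P, forall u v w, w \in R ->
    tracks u v P (eval x w) (eval (lift u v \o x) w).
Proof.
elim: R => [|w R [P IH]]; first by exists fset0.
have [P' wP'] := tracks_word x w.
exists (P `|` P')%fset => u v w'; rewrite inE => /predU1P[->|/IH wR].
  by apply: tracks_sub (wP' u v); apply: fsubsetUr.
by apply: tracks_sub (wR u v); apply: fsubsetUl.
Qed.

(** If the projection is infinite, some [m] has its projection [h] outside a
    given finite set, and the positions [u] in the support of [z] and
    [v = h * u] in the support of [z' = m * z * m^-1] give the contradiction:
    under the homomorphism induced by [lift u v], the coordinate at [1] of [z]
    is a nontrivial lamp, that of [z'] has a nontrivial cursor, and yet they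
    commute. *)
Lemma finite_projection (A B G : groupType) (f : {multiplicative G -> wreath A B}) z :
  finitely_presented G -> injective f ->
  z != 1 -> cursor (f z) = 1 ->
  finite_set (range (@cursor A B \o f)).
Proof.
move=> [n [R [g [gsurj gpres]]]] fI z1 cz; apply: contrapT => Hinf.
have [wz wzE] := gsurj z.
have fg w : eval (f \o g) w = f (eval g w) by exact: eval_hom.
have [P PE] := tracks_words (f \o g) (wz :: R).
have [u nu] : exists u, lamps (f z) u != 1.
  apply: contrapT => nu; case/eqP: z1; apply/fI; rewrite hom1.
  apply: wreath_eqP => // b; apply/eqP; apply: contrapT => /negP nb.
  by apply: nu; exists b; rewrite lamps1 in nb.
pose S := finsupp (lamps (f z)).
(* To be avoided by [h] so that, respectively, no relator sees both [c * u] and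
   [c * v], the word for [z] does not see [v], and [z] and [z'] have disjoint
   supports. *)
pose bad := [set u * (b^-1 * c) * u^-1 | b in [set` P] & c in [set` P]]
  `|` [set b * u^-1 | b in [set` P]]
  `|` [set b * c^-1 | b in [set` S] & c in [set` S]].
have badfin : finite_set bad.
  rewrite !finite_setU; split; first split.
  - exact: finite_image2.
  - exact: finite_image.
  - exact: finite_image2.
have [_ [[m _ <-] hbad]] : (range (@cursor A B \o f) `\` bad) !=set0.
  by apply/infinite_setN0/infinite_setD.
set h := (@cursor A B \o f) m in hbad; pose v := h * u.
have uvP c : c * u \in P -> c * v \notin P.
  move=> cu; apply/negP => cv; apply: hbad; left; left.
  exists (c * u) => //; exists (c * v) => //.
  by rewrite /v invgM !mulgA mulgV mul1g mulVg mul1g mulgK.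
have vP : v \notin P.
  by apply/negP => vP; apply: hbad; left; right; exists v; rewrite /v ?mulgK.
have SP b : b \in S -> h * b \notin S.
  move=> bS; apply/negP => hbS; apply: hbad; right.
  by exists (h * b) => //; exists b => //; rewrite mulgK.
have [z' z'E] : exists z', z' = m * z * m^-1 by eexists.
have cz' : cursor (f z') = 1.
  by rewrite z'E !gmulfM homV !cursorM cursorV cz mulg1 mulgV.
have lamps_z' b : lamps (f z') b
    = lamps (f m) b * lamps (f z) (h^-1 * b) * (lamps (f m) b)^-1.
  rewrite z'E !gmulfM homV !lampsM lampsV cursorM cz mulg1 -/h.
  by rewrite mulVKg.
have zz'C : z * z' = z' * z.
  apply: fI; rewrite !gmulfM; apply: commute_disjoint => // b.
  have [bS|/fsfun_dflt] := boolP (b \in S); [right|by left].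
  rewrite lamps_z'; have [/SP|/fsfun_dflt ->] := boolP (h^-1 * b \in S).
    by rewrite mulVKg bS.
  by rewrite mulg1 mulgV.
have [wz' wz'E] := gsurj z'.
pose E := eval (lift u v \o (f \o g)).
have EC : E wz * E wz' = E wz' * E wz.
  rewrite -!eval_cat; apply: (@von_dyck _ R); last first.
    by apply/gpres; rewrite !eval_cat wzE wz'E.
  move=> r rR; apply: (@tracks_trivial _ _ u v P) => //.
  have /gpres gr : pres_eq R r [::] by exact: pres_rel.
  rewrite -[X in tracks _ _ _ X](hom1 f).
  rewrite -[X in tracks _ _ _ (f X)](_ : eval g r = 1); last by rewrite gr /eval big_nil.
  by rewrite -fg; apply: PE; rewrite inE rR orbT.
have [cE0 _ E0 _] := PE u v wz (mem_head _ _).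
have [P1 /(_ u v)[cE1 vE1 _ _]] := tracks_word (f \o g) wz'.
rewrite -/E fg wzE in cE0 E0; rewrite -/E fg wz'E in cE1 vE1.
(* At the coordinate [1], [lift u v] reads exactly the positions [u] and [v]. *)
have := congr1 (fun z => lamps z 1) EC.
rewrite !lampsM cE0 cE1 cz cz' invg1 !mulg1 E0 ?mul1g // => /commute_lamp.
move=> /(_ nu); rewrite vE1 mul1g lamps_z' /v mulKg => nv.
case/eqP: nu; apply: (mulgI (lamps (f m) (h * u))).
apply: (mulIg (lamps (f m) (h * u))^-1).
by rewrite nv mulg1 mulgV.
Qed.

(** If [D] is the union of the supports of the generators and [H] the image
    of the projection, then [H * D] is finite and stable under [H], so it
    supports every product of generators and their inverses. *)
Lemma lamps_bounded (A B G : groupType) (f : {multiplicative G -> wreath A B}) :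
  finitely_presented G -> finite_set (range (@cursor A B \o f)) ->
  exists P : {fset B}, forall x b, b \notin P -> lamps (f x) b = 1.
Proof.
move=> [n [R [g [gsurj _]]]] Hfin.
set H := range (@cursor A B \o f) in Hfin.
have HM a b : H a -> H b -> H (a * b).
  by move=> [x _ <-] [y _ <-]; exists (x * y) => //=; rewrite gmulfM.
have HV a : H a -> H a^-1.
  by move=> [x _ <-]; exists x^-1 => //=; rewrite homV.
pose D := \bigcup_(i in [set: 'I_n]) [set` finsupp (lamps (f (g i)))].
have Dfin : finite_set D by apply: bigcup_finite => // i _; apply: finite_fset.
have /finite_fsetP[P PE] : finite_set [set h * d | h in H & d in D].
  exact: finite_image2.
have PH h b : H h -> h * b \in P -> b \in P.
  move=> Hh hb; have : [set` P] (h * b) by [].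
  rewrite -PE => -[h' Hh' [d Dd hE]].
  suff : [set` P] b by [].
  rewrite -PE; exists (h^-1 * h'); first exact/HM/Hh'/HV.
  by exists d => //; rewrite -mulgA hE mulKg.
have Pg i b : b \notin P -> lamps (f (g i)) b = 1.
  move=> bP; apply: fsfun_dflt; apply: contra bP => bS.
  suff : [set` P] b by [].
  rewrite -PE; exists 1; first by exists 1 => //=; rewrite hom1.
  by exists b; rewrite ?mul1g //; exists i.
exists P => x b; have [w <-] := gsurj x.
elim: w b => [|[i s] w IH] b bP; first by rewrite /eval big_nil hom1 lamps1.
rewrite eval_cons gmulfM lampsM IH ?mulg1; last first.
  by apply: contra bP; apply: PH; apply: HV; exists (if s then (g i)^-1 else g i).
case: s => /=; last exact: Pg.
rewrite homV lampsV Pg ?invg1 //; apply: contra bP; apply: PH.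
by exists (g i).
Qed.

(** * The characterization *)

Theorem corollary1p2 (A B G : groupType) :
  finitely_presented G ->
  infinite_set [set: B] ->
  isom_subgroup G (wreath A B) <->
  (isom_subgroup G B \/
   exists n : nat,
     (1 <= n)%N /\ subgroup_by_finite_subgroup {ffun 'I_n -> A} B G).
Proof.
move=> Gfp Binf; split; last first.
  case=> [/isom_subgroupP[f fI]|[n [_ ext]]]; last exact: extension_embeds ext.
  have [g gI] := base_embeds A B.
  by apply/isom_subgroupP; exists (g \o f); apply: inj_comp.
case/isom_subgroupP=> f fI.
have [|p pE] := @make_hom G B (@cursor A B \o f).
  by move=> x y /=; rewrite gmulfM.
have [pI|/existsNP[z /not_implyP[pz /eqP z1]]] := pselect (forall x, p x = 1 -> x = 1).
  by left; apply/isom_subgroupP; exists p; apply/hom_injP.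
right; have cz : cursor (f z) = 1 by rewrite -pz pE.
have pfin := finite_projection Gfp fI z1 cz.
have [P PE] := lamps_bounded Gfp pfin.
(* The successor only ensures that the exponent is positive; the additional
   coordinate is the one at the default position [1]. *)
exists (size P).+1; split=> //.
pose k x : {ffun 'I_(size P).+1 -> A} := [ffun i : 'I__ => lamps (f x) (nth 1 P i)].
apply: (@extension_of_kernel _ _ _ p k).
- rewrite (_ : range p = range (@cursor A B \o f)) //.
  by apply: eq_imagel => x _; rewrite pE.
- move=> x y; rewrite pE /= => px _; apply/ffunP => i; rewrite !ffunE gmulfM.
  by rewrite lampsM px invg1 mul1g.
- move=> x; rewrite pE /= => px kx; apply: fI; rewrite hom1.
  apply: wreath_eqP => // b; rewrite lamps1.
  have [bP|/PE//] := boolP (b \in P).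
  have ib : (index b P < (size P).+1)%N by rewrite ltnS index_size.
  have := congr1 (fun h : {ffun 'I_(size P).+1 -> A} => h (Ordinal ib)) kx.
  by rewrite /= !ffunE nth_index.
Qed.
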